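(* Let $G''$ be a graph containing a subgraph $G$ with $n$ vertices, and let $G'$ be the remainder graph on the other $n'$ vertices of $G''$, where $G$ and $G'$ contain all edges of $G''$ joining two vertices of $G$, respectively two vertices of $G'$. Suppose that exactly $p$ vertices of $G$, labeled $n-p+1,\dots,n$, are linked by edges of $G''$ to vertices of $G'$, and that exactly $p'$ vertices of $G'$, labeled $1,\dots,p'$ within $G'$, are linked to vertices of $G$. Let $L''$, $L$, $L'$ be the graph Laplacians of $G''$, $G$, $G'$, and write $$L'' = \begin{pmatrix} L & 0 \\ 0 & L'\end{pmatrix} + \begin{pmatrix} 0 & 0 & 0 & 0 \\ 0 & a & -b & 0 \\ 0 & -b^T & c & 0 \\ 0 & 0 & 0 & 0 \end{pmatrix},$$ where $a$ has size $p\times p$, $b$ has size $p\times p'$, $c$ has size $p'\times p'$, and the blocks correspond to the first $n-p$ vertices of $G$, the $p$ linked vertices of $G$, the $p'$ linked vertices of $G'$, and the remaining $n'-p'$ vertices of $G'$. Then the square matrix $$\delta=\begin{pmatrix} a & -b \\ -b^T & c\end{pmatrix}$$ is a graph Laplacian.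
   Context: Graphs are finite, with no loops and no multiple edges; $G''$ is connected. The graph Laplacian of a graph with $N$ vertices is the $N\times N$ matrix whose $(i,j)$ entry for $i\neq j$ is $-1$ if the edge $ij$ exists and $0$ otherwise, and whose $(i,i)$ entry is the degree of $i$. In the conclusion, ''is a graph Laplacian'' means that $\delta$ is the graph Laplacian of some graph with $p+p'$ vertices, not necessarily connected. *)

(* Defs.v *)
From HB Require Import structures.
From mathcomp Require Import all_boot all_order all_algebra.

Set Implicit Arguments.
Unset Strict Implicit.
Unset Printing Implicit Defensive.

Import GRing.Theory.
Local Open Scope ring_scope.

(* Finite simple graph on the vertex type T: symmetry makes edges undirected,
   irreflexivity excludes loops, and a boolean relation excludes multi-edges. *)
Record sgraph (T : finType) := SGraph {
  adj :> rel T;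
  adj_sym : symmetric adj;
  adj_irr : irreflexive adj }.

Definition connected_graph (T : finType) (G : sgraph T) : Prop :=
  forall x y : T, connect (adj G) x y.

(* For f injective, this is the subgraph induced on the image of f, with its
   vertices relabelled along f. *)
Definition induced (T U : finType) (f : T -> U) (G : sgraph U) : sgraph T :=
  @SGraph T (fun x y => adj G (f x) (f y))
    (fun x y => adj_sym G (f x) (f y)) (fun x => adj_irr G (f x)).

Definition degree (T : finType) (G : sgraph T) (x : T) : nat :=
  #|[set y | adj G x y]|.

Definition laplacian (R : numDomainType) (N : nat) (G : sgraph 'I_N) :
    'M[R]_N :=
  \matrix_(i, j) (if i == j then (degree G i)%:R
                  else if adj G i j then -1 else 0).

Definition is_graph_laplacian (R : numDomainType) (N : nat) (M : 'M[R]_N) :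
    Prop :=
  exists G : sgraph 'I_N, M = laplacian R G.

(* Main.v *)
Require Import Defs.
From HB Require Import structures.
From mathcomp Require Import all_boot all_order all_algebra.

Set Implicit Arguments.
Unset Strict Implicit.
Unset Printing Implicit Defensive.

Import GRing.Theory.
Local Open Scope ring_scope.

(** Splitting the vertices of a graph in two splits its edges into those within
    a side and those crossing from one side to the other.  Laplacians are
    additive over such a partition of the edges
    ([laplacian_edge_partition]), and the edges within the sides contribute
    exactly the block diagonal of the Laplacians of the two induced subgraphs
    ([laplacian_within]).  Hence the perturbation that must be added to
    [diag(L, L')] to get [L''] is the Laplacian of the graph [K] of crossing
    edges.  Its non-isolated vertices are the linked ones, and deleting isolated
    vertices from a graph just deletes zero rows and columns from its Laplacian
    ([laplacian_induced]); so [delta] is the Laplacian of the bipartite graph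
    formed by the crossing edges on the linked vertices. *)

(** * Laplacians, edge partitions and induced subgraphs *)

Section Laplacians.
Variable R : numDomainType.

Lemma eq_laplacian N (G H : sgraph 'I_N) :
  adj G =2 adj H -> laplacian R G = laplacian R H.
Proof.
move=> eqGH; apply/matrixP => i j; rewrite !mxE eqGH /degree.
by under eq_finset => y do rewrite eqGH.
Qed.

Lemma laplacian_sym N (G : sgraph 'I_N) i j :
  laplacian R G i j = laplacian R G j i.
Proof. by rewrite !mxE eq_sym adj_sym; case: eqP => // ->. Qed.

Lemma laplacian_isolated N (G : sgraph 'I_N) i :
  (forall j, ~~ adj G i j) -> forall j, laplacian R G i j = 0.
Proof.
move=> iso j; rewrite mxE (negPf (iso j)) /degree.
by under eq_finset => y do rewrite (negPf (iso y)); rewrite cards0 if_same.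
Qed.

(** Disjointness of the edge sets is what makes the degrees add up, and keeps
    an off-diagonal entry from being counted twice. *)
Lemma laplacian_edge_partition N (G A B : sgraph 'I_N) :
    (forall x y, adj G x y = adj A x y || adj B x y) ->
    (forall x y, ~~ (adj A x y && adj B x y)) ->
  laplacian R G = laplacian R A + laplacian R B.
Proof.
move=> GE dAB; apply/matrixP => i j; rewrite !mxE; case: eqP => _.
  rewrite -natrD; congr _%:R; rewrite /degree -cardsUI.
  have -> : [set y | adj A i y] :&: [set y | adj B i y] = set0.
    by apply/setP => y; rewrite !inE; apply: negbTE (dAB i y).
  by rewrite cards0 addn0; apply: eq_card => y; rewrite !inE GE.
rewrite GE; move: (dAB i j).
by case: (adj A i j); case: (adj B i j); rewrite ?addr0 ?add0r.
Qed.

(** When no edge leaves the image of [f], the induced subgraph is a union of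
    connected components, so no degree changes: this is what makes a principal
    submatrix of a Laplacian again a Laplacian. *)
Lemma laplacian_induced m n (f : 'I_m -> 'I_n) (G : sgraph 'I_n) :
    injective f -> (forall x y, adj G (f x) y -> y \in codom f) ->
  laplacian R (induced f G) = mxsub f f (laplacian R G).
Proof.
move=> f_inj closed; apply/matrixP => i j; rewrite !mxE (inj_eq f_inj).
case: eqP => // _; congr _%:R; rewrite /degree -(card_imset _ f_inj).
apply: eq_card => y; rewrite [RHS]inE.
apply/imsetP/idP => [[x + ->]|Gy]; first by rewrite inE.
by have /codomP[x yE] := closed _ _ Gy; exists x; rewrite // inE /= -yE.
Qed.

End Laplacians.

(** * Edges within and across the two sides of a cut *)

Section SidesOfACut.
Variables (T : finType) (G : sgraph T) (s : pred T).

Definition within : sgraph T.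
Proof.
by exists (fun x y => adj G x y && (s x == s y)) => [x y|x];
  rewrite ?adj_irr // adj_sym eq_sym.
Defined.

Definition crossing : sgraph T.
Proof.
by exists (fun x y => adj G x y && (s x != s y)) => [x y|x];
  rewrite ?adj_irr // adj_sym eq_sym.
Defined.

End SidesOfACut.

Definition left_side m n : pred 'I_(m + n) := fun x => (x < m)%N.

Lemma left_side_lshift m n (i : 'I_m) : left_side (lshift n i).
Proof. by rewrite /left_side /= ltn_ord. Qed.

Lemma left_side_rshift m n (j : 'I_n) : left_side (rshift m j) = false.
Proof. by rewrite /left_side ltnNge leq_addr. Qed.

Definition left_sideE := (left_side_lshift, left_side_rshift).

(** Each side is closed under adjacency in the graph of edges within sides, so
    the diagonal blocks are given by [laplacian_induced]. *)
Lemma laplacian_within (R : numDomainType) m n (G : sgraph 'I_(m + n)) :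
  laplacian R (within G (@left_side m n)) =
    block_mx (laplacian R (induced (@lshift m n) G)) 0
             0 (laplacian R (induced (@rshift m n) G)).
Proof.
set W := within G _.
have ->: laplacian R (induced (@lshift m n) G) = ulsubmx (laplacian R W).
  rewrite (@eq_laplacian _ _ _ (induced (@lshift m n) W)); last first.
    by move=> x y; rewrite /= !left_sideE andbT.
  apply/matrixP => i j; rewrite laplacian_induced; first by rewrite !mxE.
    exact: lshift_inj.
  move=> x y; case: (split_ordP y) => z -> /=; first by rewrite codom_f.
  by rewrite !left_sideE andbF.
have ->: laplacian R (induced (@rshift m n) G) = drsubmx (laplacian R W).
  rewrite (@eq_laplacian _ _ _ (induced (@rshift m n) W)); last first.
    by move=> x y; rewrite /= !left_sideE andbT.
  apply/matrixP => i j; rewrite laplacian_induced; first by rewrite !mxE.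
    exact: rshift_inj.
  move=> x y; case: (split_ordP y) => z -> /=.
    by rewrite !left_sideE andbF.
  by rewrite codom_f.
rewrite -[LHS]submxK; congr block_mx; apply/matrixP => i j;
  by rewrite !mxE ?eq_lrshift ?eq_rlshift /= !left_sideE andbF.
Qed.

Lemma laplacian_cut (R : numDomainType) m n (G : sgraph 'I_(m + n)) :
  laplacian R G =
    block_mx (laplacian R (induced (@lshift m n) G)) 0
             0 (laplacian R (induced (@rshift m n) G))
    + laplacian R (crossing G (@left_side m n)).
Proof.
rewrite -laplacian_within; apply: laplacian_edge_partition => x y /=;
  by case: (adj G x y); case: (_ == _).
Qed.

(** * Matrices supported on the middle two of four blocks *)

Section MiddleBlocks.
Variables q p p' q' : nat.

(** The inclusion of the middle two of the four consecutive intervals of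
    lengths [q], [p], [p'], [q'], that is, of the linked vertices. *)
Definition middle (x : 'I_(p + p')) : 'I_((q + p) + (p' + q')) :=
  match split x with
  | inl i => lshift (p' + q') (rshift q i)
  | inr j => rshift (q + p) (lshift q' j)
  end.

Lemma middle_lshift i : middle (lshift p' i) = lshift (p' + q') (rshift q i).
Proof. by rewrite /middle (unsplitK (inl i)). Qed.

Lemma middle_rshift j : middle (rshift p j) = rshift (q + p) (lshift q' j).
Proof. by rewrite /middle (unsplitK (inr j)). Qed.

Definition middleE := (middle_lshift, middle_rshift).

Lemma val_middle x : val (middle x) = (q + x)%N.
Proof.
by case: (split_ordP x) => i ->; rewrite middleE //= addnA.
Qed.

Lemma middle_inj : injective middle.
Proof.
by move=> x y /(congr1 val); rewrite !val_middle => /addnI/val_inj.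
Qed.

Lemma codom_middle_l (i : 'I_(q + p)) :
  (lshift (p' + q') i \in codom middle) = (q <= i)%N.
Proof.
apply/codomP/idP => [[x /(congr1 val)]|].
  by rewrite val_middle /= => ->; rewrite leq_addr.
case: (split_ordP i) => k -> /=; first by rewrite leqNgt ltn_ord.
by exists (lshift p' k); rewrite middleE.
Qed.

Lemma codom_middle_r (j : 'I_(p' + q')) :
  (rshift (q + p) j \in codom middle) = (j < p')%N.
Proof.
apply/codomP/idP => [[x /(congr1 val)]|].
  by rewrite val_middle /= -addnA => /addnI xE; rewrite -(ltn_add2l p) xE.
case: (split_ordP j) => k -> //= _.
by exists (rshift p k); rewrite middleE.
Qed.

Definition middle_mx (R : pzRingType) (a : 'M[R]_p) (b : 'M[R]_(p, p'))
    (c : 'M[R]_p') : 'M[R]_((q + p) + (p' + q')) :=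
  block_mx (block_mx 0 0 0 a)           (block_mx 0 0 (- b) 0)
           (block_mx 0 (- b^T) 0 0)     (block_mx c 0 0 0).

Definition block_mxEE := (block_mxEul, block_mxEur, block_mxEdl, block_mxEdr).

Lemma mxsub_middle_mx (R : pzRingType) (a : 'M[R]_p) b c :
  mxsub middle middle (middle_mx a b c) = block_mx a (- b) (- b^T) c.
Proof.
apply/matrixP => i j; rewrite mxE /middle_mx.
by case: (split_ordP i) => i' ->; case: (split_ordP j) => j' ->;
  rewrite !middleE !block_mxEE.
Qed.

(** A symmetric matrix vanishing off the middle rows is determined by its
    middle principal submatrix, hence has the four-interval block form. *)
Lemma middle_mxP (R : pzRingType) (M : 'M[R]_((q + p) + (p' + q'))) :
    (forall i j, M i j = M j i) ->
    (forall i, i \notin codom middle -> forall j, M i j = 0) ->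
  exists a b c, M = middle_mx a b c.
Proof.
move=> symM M0.
have row_l (i : 'I_q) : M (lshift (p' + q') (lshift p i)) =1 fun=> 0.
  by apply: M0; rewrite codom_middle_l -ltnNge /=.
have row_r (j : 'I_q') : M (rshift (q + p) (rshift p' j)) =1 fun=> 0.
  by apply: M0; rewrite codom_middle_r -leqNgt /= leq_addr.
have col_l i j : M i (lshift (p' + q') (lshift p j)) = 0 by rewrite symM row_l.
have col_r i j : M i (rshift (q + p) (rshift p' j)) = 0 by rewrite symM row_r.
pose D := mxsub middle middle M.
exists (ulsubmx D), (- ursubmx D), (drsubmx D).
apply/matrixP => i j; rewrite /middle_mx.
case: (split_ordP i) => i' ->; case: (split_ordP i') => i'' ->;
case: (split_ordP j) => j' ->; case: (split_ordP j') => j'' ->;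
  by rewrite !block_mxEE !mxE ?opprK ?middleE
             ?(row_l, row_r, col_l, col_r) // symM.
Qed.

End MiddleBlocks.

(* The vertices of G'' are labelled so that those of G come first; G has
   n = q + p vertices, the last p being linked, and G' has n' = p' + q'
   vertices, the first p' being linked. *)
Theorem theorem6p4 (R : numDomainType) (q p p' q' : nat)
  (G'' : sgraph 'I_((q + p) + (p' + q')))
  (G : sgraph 'I_(q + p)) (G' : sgraph 'I_(p' + q'))
  (connG'' : connected_graph G'')
  (defG : G = induced (@lshift (q + p) (p' + q')) G'')
  (defG' : G' = induced (@rshift (q + p) (p' + q')) G'')
  (linkedG : forall i : 'I_(q + p),
     (exists j : 'I_(p' + q'),
        adj G'' (lshift (p' + q') i) (rshift (q + p) j)) <-> (q <= i)%N)
  (linkedG' : forall j : 'I_(p' + q'),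
     (exists i : 'I_(q + p),
        adj G'' (lshift (p' + q') i) (rshift (q + p) j)) <-> (j < p')%N) :
  let decomposition (a : 'M[R]_p) (b : 'M[R]_(p, p')) (c : 'M[R]_p') :=
    laplacian R G'' =
      block_mx (laplacian R G) 0 0 (laplacian R G')
      + block_mx (block_mx 0 0 0 a)           (block_mx 0 0 (- b) 0)
                 (block_mx 0 (- b^T) 0 0)     (block_mx c 0 0 0) in
  (exists a b c, decomposition a b c) /\
  (forall a b c, decomposition a b c ->
     is_graph_laplacian (block_mx a (- b) (- b^T) c)).
Proof.
move=> decomposition; pose e := @middle q p p' q'.
pose K := crossing G'' (@left_side (q + p) (p' + q')).
have decompositionE a b c :
    decomposition a b c <-> laplacian R K = middle_mx q q' a b c.
  (* Cancelling the block diagonal of the two induced Laplacians on both sides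
     leaves only the Laplacian of the crossing edges. *)
  rewrite /decomposition defG defG' laplacian_cut -/K.
  by split=> [/addrI|->].
have linkedK x y : adj K x y -> x \in codom e.
  case: (split_ordP x) => i ->; case: (split_ordP y) => j -> /=;
    rewrite !left_sideE ?andbF // andbT => Gij.
    by rewrite codom_middle_l; apply/linkedG; exists j.
  by rewrite codom_middle_r; apply/linkedG'; exists j; rewrite adj_sym.
split=> [|a b c /decompositionE LK].
  have [|i out_i|a [b [c LK]]] := @middle_mxP q p p' q' R (laplacian R K).
  - exact: laplacian_sym.
  - by apply: laplacian_isolated => j; apply: contra out_i => /linkedK.
  by exists a, b, c; apply/decompositionE.
exists (induced e K); rewrite laplacian_induced.
- by rewrite LK mxsub_middle_mx.
- exact: middle_inj.
by move=> x y; rewrite adj_sym => /linkedK.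
Qed.
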